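(* Let $n,a,b,c$ be nonnegative integers with $0<a<2^{n+1}$, $b2^{n+1}+a\le c2^n$, and $c\ge 1$ odd. Then $$\nu_2\big(S(c2^n,\,b2^{n+1}+a)\big)\ \ge\ s_2(a)-1.$$
   Context: $S(n,k)$ denotes the Stirling number of the second kind: the number of partitions of an $n$-element set into exactly $k$ nonempty subsets. $\nu_2(m)$ denotes the 2-adic valuation of $m$ (the exponent of the highest power of 2 dividing $m$). $s_2(m)$ denotes the sum of the binary digits of the nonnegative integer $m$. *)

(* Defs.v *)
From mathcomp Require Import all_boot.

Set Implicit Arguments.
Unset Strict Implicit.
Unset Printing Implicit Defensive.

Definition stirling2 (n k : nat) : nat :=
  #|[set P : {set {set 'I_n}} | partition P [set: 'I_n] & #|P| == k]|.

(* Binary digits at positions i >= m vanish because m < 2 ^ m. *)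
Definition binary_digit_sum (m : nat) : nat :=
  \sum_(i < m) (m %/ 2 ^ i) %% 2.

(* Main.v *)
Require Import Defs.
From mathcomp Require Import all_boot.
From mathcomp Require Import all_algebra zify ring.

(** Write s for the binary digit sum and S(N, k) for the Stirling numbers, and
let 2^n divide N.  As k! S(N, k) is a sum of multinomial coefficients with
positive parts, it has valuation at least k - s(N).

For a < 2^(n+1), the valuation of a! is a - s(a), so it suffices that 2^(a-1)
divide a! S(N, a), which up to sign is the sum of (-1)^j C(a, j) j^N.  Even j
contribute multiples of 2^N.  For odd j = 2i + 1, expand j^N by the binomial
theorem and then i^r as the sum of m! S(r, m) C(i, m); the sum over i of
C(a, 2i + 1) C(i, m) is divisible by 2^(a-2m-1).

In general put B = b 2^(n+1).  S(N, B + a) is the complete symmetric polynomial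
of degree N - B - a in 1, ..., B, B + 1, ..., B + a, and the last a variables are
1, ..., a modulo B; so it is congruent modulo B to the sum over t of
S(B + t, B) S(N - B - t, a).  Newton's identity for the complete symmetric
polynomials S(B + t, B) of 1, ..., B, whose power sums are divisible by 2^n,
shows that 2^n divides t S(B + t, B).  If 2^n divides t, the previous case
applies to S(N - B - t, a).  Otherwise t has valuation j < n, the first factor
contributes n - j, and induction applies to the second factor: it only misses the
digits of a above position j, at most n - j of which are 1. *)

Set Implicit Arguments.
Unset Strict Implicit.
Unset Printing Implicit Defensive.

Import GRing.Theory.

(** * Stirling numbers by their recurrence *)

Fixpoint stirling2_rec (n k : nat) : nat :=
  match n, k with
  | 0, 0 => 1
  | 0, _.+1 => 0
  | _.+1, 0 => 0
  | n'.+1, k'.+1 => k'.+1 * stirling2_rec n' k'.+1 + stirling2_rec n' k'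
  end.
Arguments stirling2_rec : simpl never.
Local Notation S2 := stirling2_rec.
Local Notation s2 := binary_digit_sum.

Lemma S2_SS n k : S2 n.+1 k.+1 = k.+1 * S2 n k.+1 + S2 n k.
Proof. by []. Qed.

Lemma S2_n0 n : S2 n 0 = (n == 0).
Proof. by case: n. Qed.

Lemma S2_small n k : n < k -> S2 n k = 0.
Proof.
elim: n k => [|n IHn] [|k] // nk.
by rewrite S2_SS !IHn ?muln0 // ltnW.
Qed.

Lemma S2_diag n : S2 n n = 1.
Proof. by elim: n => // n IHn; rewrite S2_SS IHn S2_small ?muln0. Qed.

Lemma S2_gt0 n k : 0 < k <= n -> 0 < S2 n k.
Proof.
elim: n k => [|n IHn] [|k] // kn.
have [->|nk] := eqVneq k n; first by rewrite S2_diag.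
by rewrite S2_SS addn_gt0 muln_gt0 IHn //= ltn_neqAle nk.
Qed.

(** * Binary digit sums *)

Lemma s2_recl q (e : bool) : s2 (e + q.*2) = e + s2 q.
Proof.
(* The range of the sum depends on the number; [ext] permits any longer range, the added digits
   being 0. *)
have ext m p : m <= p -> s2 m = \sum_(i < p) (m %/ 2 ^ i) %% 2.
  move=> mp; rewrite /s2 -!(big_mkord predT (fun i => (m %/ 2 ^ i) %% 2)).
  rewrite [RHS](big_cat_nat (n := m)) //= [X in _ + X]big1_seq ?addn0 // => i.
  rewrite andTb mem_index_iota => /andP[mi _].
  by rewrite divn_small // (leq_ltn_trans mi) // ltn_expl.
rewrite (ext (e + q.*2) (e + q.*2).+1) // (ext q (e + q.*2)); last by lia.
rewrite big_ord_recl; congr (_ + _).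
  by rewrite expn0 divn1; case: e; lia.
have q2 : (e + q.*2) %/ 2 = q by case: e; lia.
by apply: eq_bigr => i _; rewrite lift0 expnS divnMA q2.
Qed.

Lemma s2_0 : s2 0 = 0.
Proof. by rewrite /s2 big_ord0. Qed.

Lemma s2_double q : s2 q.*2 = s2 q.
Proof. exact: (s2_recl q false). Qed.

Lemma s2_doubleS q : s2 q.*2.+1 = (s2 q).+1.
Proof. exact: (s2_recl q true). Qed.

(** The increment turns the trailing ones of [m], [logn 2 m.+1] in number, into zeros and the zero
    above them into a one. *)
Lemma s2S m : s2 m.+1 + logn 2 m.+1 = (s2 m).+1.
Proof.
elim/ltn_ind: m => m IHm.
have -> : m = odd m + m./2.*2 by rewrite odd_double_half.
case mo: (odd m); rewrite ?add1n ?add0n.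
  rewrite -doubleS s2_double s2_doubleS -mul2n lognM // logn_prime // eqxx.
  rewrite add1n addnS IHm //; move: mo; lia.
rewrite s2_doubleS s2_double lognE /=.
by rewrite dvdn2 /= odd_double /= addn0.
Qed.

(** Legendre's formula at the prime 2. *)
Lemma s2_fact m : s2 m + logn 2 m`! = m.
Proof.
elim: m => [|m IHm]; first by rewrite s2_0 logn1.
by rewrite factS lognM ?fact_gt0 // addnA s2S addSn IHm.
Qed.

(** Kummer's theorem at 2, from Legendre's formula for the three factorials. *)
Lemma s2_bin m j : j <= m -> s2 m + logn 2 'C(m, j) = s2 j + s2 (m - j).
Proof.
move=> jm; have := congr1 (logn 2) (bin_fact jm).
rewrite !lognM ?muln_gt0 ?fact_gt0 ?bin_gt0 //.
have := s2_fact m; have := s2_fact j; have := s2_fact (m - j); lia.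
Qed.

Lemma s2D m p : s2 (m + p) <= s2 m + s2 p.
Proof. by have := @s2_bin (m + p) m (leq_addr _ _); rewrite addKn; lia. Qed.

Lemma s2_le m : s2 m <= m.
Proof. by have := s2_fact m; lia. Qed.

Lemma s2_gt0 m : 0 < m -> 0 < s2 m.
Proof.
elim/ltn_ind: m => m IHm m0.
have mE : m = odd m + m./2.*2 by rewrite odd_double_half.
rewrite mE s2_recl; case: (odd m) mE => //= mE.
by apply: IHm; lia.
Qed.

Lemma s2_pow_mul q j : s2 (q * 2 ^ j) = s2 q.
Proof.
by elim: j => [|j IHj]; rewrite ?muln1 // expnS mulnCA mul2n s2_double.
Qed.

Lemma s2_lt_pow n m : m < 2 ^ n -> s2 m <= n.
Proof.
elim: n m => [|n IHn] m; first by case: m => // _; rewrite s2_0.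
rewrite expnS => mn; rewrite -(odd_double_half m) s2_recl.
apply: leq_trans (_ : 1 + n <= _) => //; apply: leq_add; first by case: odd.
by apply: IHn; lia.
Qed.

(** Of the [n] digits of [r], the lowest [logn 2 r] are zeros. *)
Lemma s2_logn_lt_pow n r : 0 < r < 2 ^ n -> s2 r + logn 2 r <= n.
Proof.
case: r => [|r] //= rn; rewrite s2S.
elim: n r rn => [|n IHn] r; first by rewrite expn0; lia.
rewrite expnS => rn; rewrite -(odd_double_half r) s2_recl.
case: (boolP (odd r)) => ro; rewrite ?add1n ?add0n ltnS.
  by apply: IHn; lia.
by apply: s2_lt_pow; lia.
Qed.

(** * Surjection numbers *)

(** Combinatorially, [j] counts the elements outside the block of a fixed element. *)
Lemma bin_S2_sum n k : \sum_(j < n.+1) 'C(n, j) * S2 j k = S2 n.+1 k.+1.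
Proof.
elim: n k => [|n IHn] k.
  by rewrite big_ord_recl big_ord0 bin0 mul1n addn0 S2_SS muln0.
rewrite big_ord_recl bin0 mul1n.
under eq_bigr => i _ do rewrite lift0 binS mulnDl.
rewrite big_split /= addnA.
have -> : S2 0 k + \sum_(i < n.+1) 'C(n, i.+1) * S2 i.+1 k = S2 n.+1 k.+1.
  rewrite -IHn big_ord_recr /= bin_small // mul0n addn0.
  by rewrite [RHS]big_ord_recl bin0 mul1n.
rewrite (S2_SS n.+1) mulSn -addnA; congr (_ + _).
case: k => [|k].
  by rewrite big1 // => i _; rewrite S2_n0 muln0.
under eq_bigr => i _ do rewrite S2_SS mulnDr mulnCA.
by rewrite big_split /= -big_distrr /= !IHn.
Qed.

(* [surj n k] counts the surjections from an [n]-set onto a [k]-set. *)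
Definition surj n k := k`! * S2 n k.

(** Here [j] counts the elements not sent to a fixed point; [j < n] since the fibre of that point is
    nonempty. *)
Lemma surjS n k : surj n k.+1 = \sum_(j < n) 'C(n, j) * surj j k.
Proof.
have /eqP := bin_S2_sum n k.
rewrite big_ord_recr /= binn mul1n eqn_add2r => /eqP h.
rewrite /surj factS mulnAC mulnC -h big_distrr /=.
by apply: eq_bigr => j _; rewrite mulnCA.
Qed.

(* The multinomial coefficients summing to k! S(n,k) have valuation
   s2 n1 + ... + s2 nk - s2 n with all ni > 0. *)
Lemma dvdn_surj n k : 2 ^ (k - s2 n) %| surj n k.
Proof.
suff h : 2 ^ k %| 2 ^ s2 n * surj n k.
  case: (leqP k (s2 n)) => [|/ltnW] kn; first by rewrite (eqP (_ : k - s2 n == 0)).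
  by rewrite -(@dvdn_pmul2l (2 ^ s2 n)) ?expn_gt0 // -expnD subnKC.
elim: k n => [|k IHk] n; first by rewrite dvd1n.
rewrite surjS big_distrr /=; apply: dvdn_sum => j _.
have jn := ltn_ord j; rewrite mulnA.
(* Each unfolding of [surjS] gains a factor 2, because [s2 (n - j)] is positive in [s2_bin]. *)
have : 2 ^ (1 + s2 j) %| 2 ^ s2 n * 'C(n, j).
  rewrite pfactor_dvdn ?muln_gt0 ?expn_gt0 ?bin_gt0 ?(ltnW jn) //.
  rewrite lognM ?expn_gt0 ?bin_gt0 ?(ltnW jn) // pfactorK //.
  have := s2_bin (ltnW jn); have /s2_gt0 : 0 < n - j by lia.
  lia.
move=> /(dvdn_mul (dvdnn (surj j k))); rewrite [_ * (_ * _)]mulnC.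
apply: dvdn_trans; rewrite expnD mulnCA expnS dvdn_pmul2l //.
by rewrite mulnC IHk.
Qed.

(** The maps from an [n]-set to an [x]-set, sorted by the size [m] of their image. *)
Lemma sum_surj_bin n x : x ^ n = \sum_(m < n.+1) surj n m * 'C(x, m).
Proof.
elim: n => [|n IHn]; first by rewrite big_ord1 bin0 muln1.
rewrite big_ord_recl /surj S2_n0 muln0 mul0n add0n.
under eq_bigr => i _ do rewrite lift0 S2_SS mulnDr mulnDl.
rewrite big_split /= expnS IHn big_distrr /=.
under eq_bigr => i _.
  have -> : x * (surj n i * 'C(x, i)) =
      surj n i * (i * 'C(x, i)) + surj n i * (i.+1 * 'C(x, i.+1)).
    rewrite -mulnDr mulnCA; congr (_ * _).
    case: (leqP i x) => ix; last by rewrite !bin_small ?muln0 // leqW.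
    by rewrite mul_bin_left -mulnDl subnKC.
  over.
rewrite big_split /=; congr (_ + _).
  rewrite big_ord_recl [RHS]big_ord_recr /= mul0n muln0 add0n.
  rewrite [S2 n n.+1]S2_small // !muln0 mul0n addn0.
  by apply: eq_bigr => i _; rewrite /surj /bump add1n; ring.
by apply: eq_bigr => i _; rewrite /surj factS; ring.
Qed.

(** * Counting set partitions *)

Section CardPartitions.
Variable T : finType.
Implicit Types (D B : {set T}) (P Q : {set {set T}}) (x : T) (k : nat).

Definition kpartitions D k := [set P | partition P D & #|P| == k].

Lemma mem_kpartitions P D k :
  (P \in kpartitions D k) = partition P D && (#|P| == k).
Proof. by rewrite inE. Qed.

Lemma kpartitions_setU1_singleton D x k : x \notin D ->
  #|[set P in kpartitions (x |: D) k.+1 | [set x] \in P]| = #|kpartitions D k|.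
Proof.
move=> xD.
have xQ Q : partition Q D -> [set x] \notin Q.
  move=> pQ; apply/negP => /(partitionS pQ).
  by rewrite sub1set (negPf xD).
have -> : [set P in kpartitions (x |: D) k.+1 | [set x] \in P] =
    [set [set x] |: Q | Q in kpartitions D k].
  apply/setP => P; apply/idP/imsetP => [|[Q]].
    rewrite inE mem_kpartitions => /andP[/andP[pP /eqP cP] xP].
    exists (P :\ [set x]); last by rewrite setD1K.
    rewrite mem_kpartitions; have := partitionD1 pP xP.
    rewrite setU1K // => -> /=.
    by rewrite -eqSS -cP (cardsD1 [set x] P) xP.
  rewrite mem_kpartitions => /andP[pQ /eqP cQ] ->.
  rewrite inE mem_kpartitions setU11 andbT cardsU1 xQ // cQ eqxx andbT.
  apply: partitionU1 => //; first by apply/set0Pn; exists x; rewrite set11.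
  by rewrite disjoints1.
apply: card_in_imset => Q R; rewrite !mem_kpartitions => /andP[pQ _] /andP[pR _] QR.
by rewrite -(setU1K (xQ _ pQ)) QR setU1K // xQ.
Qed.

(** Such a partition arises from exactly one partition [Q] of [D] with a marked block [B], by
    putting [x] into [B]; [f] is this bijection. *)
Lemma kpartitions_setU1_other D x k : x \notin D ->
  #|[set P in kpartitions (x |: D) k | [set x] \notin P]| =
  k * #|kpartitions D k|.
Proof.
move=> xD.
pose E := [set u : {set {set T}} * {set T} | u.1 \in kpartitions D k & u.2 \in u.1].
pose f (u : {set {set T}} * {set T}) := (x |: u.2) |: (u.1 :\ u.2).
have cE : #|E| = k * #|kpartitions D k|.
  rewrite mulnC -sum_nat_const -sum1dep_card.
  rewrite -(pair_big_dep (mem (kpartitions D k)) (fun Q B => B \in Q) (fun _ _ => 1)) /=.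
  apply: eq_bigr => Q; rewrite sum1_card mem_kpartitions => /andP[_ /eqP <-].
  by [].
have xB Q B : partition Q D -> B \in Q -> x \notin B.
  by move=> pQ /(partitionS pQ) BD; apply: contra xD; apply: subsetP.
have xBQ Q B : partition Q D -> x |: B \notin Q.
  by move=> pQ; apply/negP => /(xB _ _ pQ); rewrite setU11.
have pf Q B : partition Q D -> B \in Q -> partition (f (Q, B)) (x |: D).
  move=> pQ BQ.
  have -> : x |: D = (x |: B) :|: (D :\: B).
    apply/setP => y; rewrite !inE.
    have := subsetP (partitionS pQ BQ) y.
    by case: (y \in B); case: (y \in D); case: (y == x) => // /(_ isT).
  apply: partitionU1; first exact: partitionD1.
    by apply/set0Pn; exists x; rewrite setU11.
  rewrite -setI_eq0; apply/eqP/setP => y; rewrite !inE.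
  by case: eqP => [->|]; rewrite ?(negPf xD) ?andbF //=; case: (y \in B).
(* The block of [x] recovers [B], which makes [f] injective. *)
have pbf Q B : partition Q D -> B \in Q -> pblock (f (Q, B)) x = x |: B.
  move=> pQ BQ; apply: def_pblock (partition_trivIset (pf _ _ pQ BQ)) _ _.
    by rewrite setU11.
  by rewrite setU11.
rewrite -cE -(card_in_imset (f := f)); last first.
  move=> [Q B] [Q' B']; rewrite !inE /=.
  move=> /andP[/andP[pQ _] BQ] /andP[/andP[pQ' _] BQ'] ff.
  have := pbf _ _ pQ BQ; rewrite ff pbf // => xBB.
  have BB : B = B'.
    by rewrite -(setU1K (xB _ _ pQ BQ)) -xBB setU1K // (xB _ _ pQ' BQ').
  rewrite -BB in ff BQ' *; congr (_, _).
  rewrite -(setD1K BQ) -(setD1K BQ'); congr (_ |: _).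
  have nQ R : partition R D -> x |: B \notin R :\ B.
    by move=> pR; rewrite !inE negb_and xBQ ?orbT.
  by rewrite -(setU1K (nQ _ pQ)) -(setU1K (nQ _ pQ')); congr (_ :\ _).
apply: eq_card => P; apply/idP/imsetP => [|[[Q B]]].
  rewrite !inE => /andP[/andP[pP /eqP cP] xP].
  have xPc : x \in cover P by rewrite (cover_partition pP) setU11.
  pose A := pblock P x; have AP : A \in P by apply: pblock_mem.
  have xA : x \in A by rewrite mem_pblock.
  have B0 : A :\ x != set0.
    by apply: contra xP => /eqP B0; rewrite -(setD1K xA) B0 setU0 in AP.
  have xB' : x \notin A :\ x by rewrite !inE eqxx.
  have pPA := partitionD1 pP AP.
  have BPA : A :\ x \notin P :\ A.
    apply/negP => /(partitionS pPA) /subsetP sB.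
    have /set0Pn[y yB] := B0; have := sB y yB.
    by move: yB; rewrite !inE => /andP[_ ->].
  exists ((A :\ x) |: (P :\ A), A :\ x).
    rewrite !inE /= eqxx andbT cardsU1 BPA -cP (cardsD1 A P) AP eqxx andbT.
    have -> : D = (A :\ x) :|: ((x |: D) :\: A).
      apply/setP => y; rewrite !inE; have := subsetP (partitionS pP AP) y; rewrite !inE.
      case: eqP => [->|_] /=; first by rewrite (negPf xD) xA.
      by case: (y \in A) => //= ->.
    apply: partitionU1 => //; rewrite -setI_eq0; apply/eqP/setP => y.
    by rewrite !inE; case: (y \in A); rewrite ?andbF.
  by rewrite /f /= setU1K // setD1K // setD1K.
rewrite !inE /= => /andP[/andP[pQ /eqP cQ] BQ] ->.
rewrite pf //=.
rewrite cardsU1 !inE negb_and xBQ ?orbT // -cQ (cardsD1 B Q) BQ eqxx /=.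
apply/negP => /orP[/eqP xBx|/andP[_ /(xB _ _ pQ)]].
  have /set0Pn[y yB] := partition_neq0 pQ BQ.
  have : y \in [set x] by rewrite xBx inE yB orbT.
  by rewrite inE => /eqP yx; move: (xB _ _ pQ BQ); rewrite -yx yB.
by rewrite set11.
Qed.

Lemma card_kpartitions D k : #|kpartitions D k| = S2 #|D| k.
Proof.
elim: {D}#|D| {-2}D (erefl #|D|) k => [|n IHn] D cD k.
  move/eqP: cD; rewrite cards_eq0 => /eqP ->.
  have -> : kpartitions set0 k = if k is 0 then [set set0] else set0.
    apply/setP => P; rewrite mem_kpartitions partition_set0.
    by case: k => [|k]; rewrite !inE; case: eqP => [->|]; rewrite ?cards0.
  by case: k => [|k]; rewrite ?cards1 ?cards0.
have /card_gt0P[x xD] : 0 < #|D| by rewrite cD.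
have cD' : #|D :\ x| = n by move: cD; rewrite (cardsD1 x D) xD => -[].
have xD' : x \notin D :\ x by rewrite !inE eqxx.
rewrite cD -(setD1K xD); case: k => [|k].
  rewrite S2_n0 eq_card0 // => P; rewrite mem_kpartitions cards_eq0.
  apply/negP => /andP[/cover_partition pP /eqP P0]; move: pP.
  rewrite P0 /cover big_set0 => /setP/(_ x).
  by rewrite !inE eqxx.
rewrite S2_SS -{1 2}cD' -!IHn //.
rewrite -(kpartitions_setU1_other _ xD') -(kpartitions_setU1_singleton _ xD') addnC.
rewrite -(cardsID [set P : {set {set T}} | [set x] \in P]).
by congr (_ + _); apply: eq_card => P; rewrite !inE // andbC.
Qed.

End CardPartitions.

Lemma stirling2E n k : stirling2 n k = S2 n k.
Proof. by have := card_kpartitions [set: 'I_n] k; rewrite cardsT card_ord. Qed.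

(** * Stirling numbers S(N, a) with a < 2^(n+1) *)

(** Pascal's rule in both binomials, with the even-index sums [v] eliminated, gives
    [w a.+2 m.+1 = 2 * w a.+1 m.+1 + w a m]; both terms carry the required power of 2. The bound on
    [K] ensures that no nonzero term is cut off. *)
Lemma dvdn_sum_odd_bin K a m : a < K.*2 ->
  2 ^ (a - m.*2.+1) %| \sum_(i < K) 'C(a, i.*2.+1) * 'C(i, m).
Proof.
pose w a m := \sum_(i < K) 'C(a, i.*2.+1) * 'C(i, m).
pose v a m := \sum_(i < K) 'C(a, i.*2) * 'C(i, m).
rewrite -/(w a m).
have wS b l : w b.+1 l = v b l + w b l.
  by rewrite /w /v -big_split; apply: eq_bigr => i _; rewrite binS /=; lia.
have vS b l : b.+1 < K.*2 ->
    v b.+1 l = v b l + \sum_(i < K) 'C(b, i.*2.+1) * 'C(i.+1, l).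
  rewrite /v; case: (K) => [|k] // bk.
  rewrite big_ord_recl [X in _ = X + _]big_ord_recl !bin0 -addnA; congr (_ + _).
  rewrite [X in _ = _ + X]big_ord_recr /= [X in X * _]bin_small; last by lia.
  rewrite mul0n addn0 -big_split; apply: eq_bigr => i _.
  by rewrite /bump add1n doubleS binS mulnDl.
have wSS b l : b.+2 < K.*2 -> w b.+2 l.+1 = 2 * w b.+1 l.+1 + w b l.
  move=> bK; rewrite wS vS; last by lia.
  under eq_bigr => i _ do rewrite binS mulnDr.
  by rewrite big_split /= -/(w b l) -/(w b l.+1) (wS b l.+1); lia.
have wSS0 b : b.+2 < K.*2 -> w b.+2 0 = 2 * w b.+1 0.
  move=> bK; rewrite wS vS; last by lia.
  under eq_bigr => i _ do rewrite bin0.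
  have -> : \sum_(i < K) 'C(b, i.*2.+1) * 1 = w b 0.
    by apply: eq_bigr => i _; rewrite bin0.
  by rewrite (wS b); lia.
elim/ltn_ind: a m => -[|[|a]] IHa m aK.
- by rewrite sub0n dvd1n.
- by rewrite subSS sub0n dvd1n.
case: m => [|m].
  rewrite wSS0 // (_ : a.+2 - 1 = (a.+1 - 1).+1); last by lia.
  by rewrite expnS dvdn_pmul2l //; apply: (IHa a.+1 _ 0) => //; lia.
rewrite wSS // dvdn_add //.
  case: (leqP a.+2 m.+1.*2.+1) => am.
    by rewrite (eqP (_ : a.+2 - _ == 0)) ?dvd1n.
  rewrite (_ : a.+2 - _ = (a.+1 - m.+1.*2.+1).+1); last by lia.
  by rewrite expnS dvdn_pmul2l // IHa //; lia.
by rewrite doubleS !subSS IHa //; lia.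
Qed.

(** From [r * 'C(N, r) = N * 'C(N.-1, r.-1)]. *)
Lemma dvdn_bin_pow n N r : 2 ^ n %| N -> 0 < r -> 2 ^ (n - logn 2 r) %| 'C(N, r).
Proof.
case: r => // r nN _; case: N nN => [|N] nN; first by rewrite bin0n dvdn0.
case: (leqP r N) => rN; last by rewrite bin_small ?dvdn0.
rewrite pfactor_dvdn ?bin_gt0 //.
have := congr1 (logn 2) (mul_bin_diag N.+1 r).
rewrite !lognM ?bin_gt0 //.
by move: nN; rewrite pfactor_dvdn //; lia.
Qed.

Lemma dvdn_sum_odd_bin_pow n N a K : 2 ^ n %| N -> a < 2 ^ n.+1 -> a < K.*2 ->
  2 ^ a.-1 %| \sum_(i < K) 'C(a, i.*2.+1) * i.*2.+1 ^ N.
Proof.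
move=> nN an aK.
have -> : \sum_(i < K) 'C(a, i.*2.+1) * i.*2.+1 ^ N =
    \sum_(r < N.+1) \sum_(m < r.+1)
      'C(N, r) * 2 ^ r * surj r m * \sum_(i < K) 'C(a, i.*2.+1) * 'C(i, m).
  under eq_bigr => i _.
    rewrite -add1n -mul2n expnDn big_distrr /=.
    under eq_bigr => r _.
      rewrite exp1n mul1n expnMn (sum_surj_bin r i) !big_distrr /=.
      over.
    over.
  rewrite exchange_big; apply: eq_bigr => r _.
  rewrite exchange_big; apply: eq_bigr => m _.
  by rewrite big_distrr; apply: eq_bigr => i _ /=; rewrite add1n mul2n; ring.
apply: dvdn_sum => r _; apply: dvdn_sum => m _.
(* If [a < 2m + 1], every term vanishes: [i < m] kills the second binomial, [i >= m] the first. *)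
case: (ltnP a m.*2.+1) => am.
  rewrite big1 ?muln0 ?dvdn0 // => i _.
  case: (ltnP i m) => im; first by rewrite (bin_small im) muln0.
  by rewrite bin_small //; lia.
have mr : m <= r by rewrite -ltnS.
have := dvdn_sum_odd_bin m aK.
set W := \sum_(i < K) _ => dW.
case: (posnP r) => r0.
  have m0 : m = 0 :> nat by lia.
  by rewrite m0 subn1 in dW; rewrite dvdn_mull.
apply: dvdn_trans (dvdn_mul (dvdn_mul (dvdn_mul (dvdn_bin_pow nN r0)
  (dvdnn _)) (dvdn_surj r m)) dW).
(* It remains to see that [m + logn 2 r + s2 r <= n + r] when [r < 2 ^ n], and that [m + s2 r <= r]
   otherwise. *)
rewrite -!expnD dvdn_exp2l //.
have mn : m < 2 ^ n by rewrite expnS in an; lia.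
case: (ltnP r (2 ^ n)) => rn.
  have := @s2_logn_lt_pow n r; rewrite r0 rn => /(_ isT).
  by lia.
(* Splitting off [2 ^ n] gives [s2 r <= 1 + (r - 2 ^ n)], so [r - s2 r >= 2 ^ n - 1 >= m]. *)
have := s2D (2 ^ n) (r - 2 ^ n); rewrite subnKC //.
have := s2_pow_mul 1 n; rewrite mul1n => ->.
have -> : s2 1 = 1 by have := s2_doubleS 0; rewrite s2_0.
by have := s2_le (r - 2 ^ n); lia.
Qed.

Section AlternatingSum.
Local Open Scope ring_scope.

(** Inclusion-exclusion over the missed points; the base case [N = 0] is the expansion of
    [(1 - 1) ^ a]. *)
Lemma surj_alt N a :
  (surj N a)%:Z = \sum_(j < a.+1) (-1) ^+ (a + j) * ('C(a, j) * j ^ N)%:Z.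
Proof.
elim: N a => [|N IHN] a.
  case: a => [|a]; first by rewrite big_ord1.
  rewrite /surj S2_small // muln0.
  have := exprDn (1 : int) (-1) a.+1.
  rewrite subrr expr0n /= => /(congr1 (fun x => (-1) ^+ a.+1 * x)).
  rewrite mulr0 big_distrr => h; apply: (etrans h); apply: eq_bigr => j _ /=.
  by rewrite expr1n mul1r muln1 exprD -mulr_natr mulrA; congr (_ * _); rewrite natz.
case: a => [|a].
  by rewrite big_ord1 /surj S2_n0 exp0n // !muln0.
have -> : (surj N.+1 a.+1)%:Z = a.+1%:Z * ((surj N a.+1)%:Z + (surj N a)%:Z).
  by rewrite /surj S2_SS factS; lia.
rewrite !IHN.
have -> : \sum_(j < a.+1) (-1) ^+ (a + j) * ('C(a, j) * j ^ N)%:Z =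
   \sum_(j < a.+2) (-1) ^+ (a + j) * ('C(a, j) * j ^ N)%:Z.
  by rewrite [RHS]big_ord_recr /= bin_small // mul0n mulr0 addr0.
rewrite -big_split big_distrr; apply: eq_bigr => j _ /=.
have ja : (j <= a.+1)%N by rewrite -ltnS.
have h : ('C(a.+1, j) * j + a.+1 * 'C(a, j) = a.+1 * 'C(a.+1, j))%N.
  rewrite (mul_bin_down a.+1 j) mulnC -mulnDl; congr (_ * _)%N; lia.
have hz : 'C(a.+1, j)%:Z * j%:Z = a.+1%:Z * ('C(a.+1, j)%:Z - 'C(a, j)%:Z) by lia.
rewrite !PoszM expnS PoszM mulrA hz addSn exprS; ring.
Qed.

End AlternatingSum.

Lemma sum_odd_half K (F : nat -> nat) :
  \sum_(j < K.*2 | odd j) F j = \sum_(i < K) F i.*2.+1.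
Proof.
elim: K => [|K IHK]; first by rewrite !big_ord0.
rewrite [RHS]big_ord_recr /= -IHK [LHS]big_mkcond [X in _ = X + _]big_mkcond.
by rewrite doubleS !big_ord_recr /= odd_double addn0.
Qed.

Lemma dvdn_surj_pow n N a : 2 ^ n %| N -> a < 2 ^ n.+1 -> 2 ^ a.-1 %| surj N a.
Proof.
move=> nN an.
case: (ltnP N a) => [Na|aN]; first by rewrite /surj S2_small // muln0 dvdn0.
suff : ((2 ^ a.-1)%:Z %| (surj N a)%:Z)%Z by rewrite dvdzE.
rewrite surj_alt (bigID (fun j : 'I__ => odd j)) /=; apply: rpredD.
  have -> : (\sum_(j < a.+1 | odd j) (-1) ^+ (a + j) * ('C(a, j) * j ^ N)%:Z =
     (-1) ^+ a.+1 * (\sum_(j < a.+1 | odd j) 'C(a, j) * j ^ N)%N%:Z)%R.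
    rewrite (big_morph Posz PoszD (erefl _)) big_distrr /=.
    apply: eq_bigr => j jo; congr (_ * _)%R.
    by rewrite exprD -[in RHS]addn1 exprD -(signr_odd _ j) jo.
  apply: dvdz_mull; rewrite dvdzE /=.
  (* Zero terms are added to reach an even range, as [sum_odd_half] expects. *)
  have <- : \sum_(j < a.+1.*2 | odd j) 'C(a, j) * j ^ N = \sum_(j < a.+1 | odd j) 'C(a, j) * j ^ N.
    rewrite [RHS](big_ord_widen_cond a.+1.*2 odd (fun j => 'C(a, j) * j ^ N)); last by lia.
    rewrite [LHS](bigID (fun j : 'I__ => j < a.+1)) /= [X in _ + X]big1 ?addn0 // => j /andP[_ ja].
    by rewrite bin_small // ltnNge.
  by rewrite (sum_odd_half _ (fun j => 'C(a, j) * j ^ N)); apply: (dvdn_sum_odd_bin_pow nN an); lia.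
apply: rpred_sum => j jo; apply: dvdz_mull; rewrite dvdzE /=.
apply: dvdn_mull; apply: dvdn_trans (dvdn_exp2r _ (_ : 2 %| j)).
  by apply: dvdn_exp2l; lia.
by rewrite dvdn2.
Qed.

(** * Reduction to that case *)

Lemma dvdn_S2_small n N a : 2 ^ n %| N -> a < 2 ^ n.+1 ->
  2 ^ (s2 a - 1) %| S2 N a.
Proof.
move=> nN an; have := dvdn_surj_pow nN an.
case: (posnP (S2 N a)) => [-> //|S0].
rewrite !pfactor_dvdn ?muln_gt0 ?fact_gt0 // lognM ?fact_gt0 //.
by have := s2_fact a; lia.
Qed.

(** Both sides obey the same recurrence, since the factor [B + a.+1] in that of [S2] is [a.+1]
    modulo [B]. *)
Lemma S2_add_mod N B a :
  S2 N (B + a) = \sum_(i < N.+1) S2 i B * S2 (N - i) a %[mod B].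
Proof.
elim: N a => [|N IHN] a.
  case: a => [|a]; first by rewrite addn0 big_ord1 muln1.
  by rewrite addnS big_ord1 muln0.
case: a => [|a].
  rewrite addn0 big_ord_recr /= subnn muln1 big1 // => i _.
  by rewrite subSn ?S2_n0 ?muln0 // -ltnS.
rewrite addnS S2_SS big_ord_recr /= subnn [S2 0 _]/= muln0 addn0 -addnS.
have -> : \sum_(i < N.+1) S2 i B * S2 (N.+1 - i) a.+1 =
    a.+1 * \sum_(i < N.+1) S2 i B * S2 (N - i) a.+1 +
    \sum_(i < N.+1) S2 i B * S2 (N - i) a.
  rewrite big_distrr -big_split; apply: eq_bigr => i _ /=.
  have iN : i <= N by rewrite -ltnS.
  by rewrite subSn // S2_SS mulnDr mulnCA.
rewrite mulnDl -addnA mulnC modnMDl.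
by rewrite -modnDm -modnMmr !IHN modnMmr modnDm.
Qed.

(* [S2 (k + t) k] is the complete homogeneous symmetric polynomial of degree t
   in 1, ..., k; this is its Newton identity with power sums. *)
Lemma S2_newton k t :
  t * S2 (k + t) k =
  \sum_(r < t) (\sum_(i < k) i.+1 ^ r.+1) * S2 (k + (t - r.+1)) k.
Proof.
have hSS l u : S2 (l.+1 + u.+1) l.+1 = l.+1 * S2 (l.+1 + u) l.+1 + S2 (l + u.+1) l.
  by rewrite addnS S2_SS addSnnS.
(* Expansion of the symmetric polynomial by the exponent [r] of its last variable [l.+1]. *)
have hsum l u : \sum_(r < u.+1) l.+1 ^ r * S2 (l + (u - r)) l = S2 (l.+1 + u) l.+1.
  elim: u => [|u IHu]; first by rewrite big_ord1 !addn0 !S2_diag.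
  rewrite big_ord_recl mul1n subn0 hSS addnC -IHu big_distrr; congr (_ + _).
  by apply: eq_bigr => r _; rewrite /= /bump add1n expnS mulnA subSS.
elim: k t => [|k IHk] t.
  by rewrite big1 => [|r _]; rewrite ?big_ord0 // S2_n0; case: t => // t; rewrite muln0.
elim: t => [|t IHt]; first by rewrite big_ord0.
have splitS : \sum_(r < t.+1) (\sum_(i < k.+1) i.+1 ^ r.+1) * S2 (k.+1 + (t.+1 - r.+1)) k.+1 =
    k.+1 * (\sum_(r < t) (\sum_(i < k.+1) i.+1 ^ r.+1) * S2 (k.+1 + (t - r.+1)) k.+1) +
    \sum_(r < t.+1) (\sum_(i < k.+1) i.+1 ^ r.+1) * S2 (k + (t.+1 - r.+1)) k.
  rewrite big_ord_recr [in RHS]big_ord_recr /= subnn !addn0 !S2_diag addnA.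
  congr (_ + _); rewrite big_distrr -big_split; apply: eq_bigr => r _ /=.
  by rewrite subSS -subnSK // hSS mulnDr mulnCA.
(* The powers of the last variable [k.+1] leave the power sums and are collected by [hsum]. *)
have splitp : \sum_(r < t.+1) (\sum_(i < k.+1) i.+1 ^ r.+1) * S2 (k + (t.+1 - r.+1)) k =
    \sum_(r < t.+1) (\sum_(i < k) i.+1 ^ r.+1) * S2 (k + (t.+1 - r.+1)) k +
    k.+1 * S2 (k.+1 + t) k.+1.
  rewrite -hsum big_distrr -big_split; apply: eq_bigr => r _ /=.
  by rewrite big_ord_recr mulnDl expnS subSS mulnA.
by rewrite splitS splitp -IHt hSS mulnDr IHk; ring.
Qed.

(** The two halves of the range agree modulo [2 ^ n.+1], so doubling the range gains a factor 2. *)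
Lemma dvdn_power_sum n b r : 0 < r ->
  2 ^ n %| \sum_(i < b * 2 ^ n.+1) i.+1 ^ r.
Proof.
move=> r0; elim: n b => [|n IHn] b; first exact: dvd1n.
set X := b * 2 ^ n.+1.
have -> : b * 2 ^ n.+2 = X + X by rewrite /X !expnS; lia.
rewrite big_split_ord /=.
set s := \sum_(i < X) _.
have h : s = \sum_(i < X) (X + i).+1 ^ r %[mod 2 ^ n.+1].
  rewrite /s -modn_summ -[in RHS]modn_summ; congr (_ %% _).
  apply: eq_bigr => i _; rewrite -modnXm -[in RHS]modnXm -addnS.
  by rewrite modnMDl.
rewrite /dvdn -modnDmr -h modnDmr addnn -mul2n expnS -muln_modr.
by rewrite muln_eq0 /= (eqP (IHn b)).
Qed.

Lemma dvdn_mul_S2 n b t :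
  2 ^ n %| t * S2 (b * 2 ^ n.+1 + t) (b * 2 ^ n.+1).
Proof.
by rewrite S2_newton; apply: dvdn_sum => r _; rewrite dvdn_mulr // dvdn_power_sum.
Qed.

Lemma dvdn_S2 n N a b : 2 ^ n %| N -> 0 < a < 2 ^ n.+1 ->
  2 ^ (s2 a - 1) %| S2 N (b * 2 ^ n.+1 + a).
Proof.
elim/ltn_ind: n N a b => n IHn N a b nN /andP[a0 an].
set B := b * 2 ^ n.+1.
(* Hence the target power of 2 divides [B], and a congruence modulo [B] suffices. *)
have sn : s2 a - 1 <= n by have := s2_lt_pow an; lia.
have sB : 2 ^ (s2 a - 1) %| B by rewrite dvdn_mull // dvdn_exp2l // ltnW.
rewrite /dvdn -(modn_dvdm _ sB) S2_add_mod (modn_dvdm _ sB).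
apply: dvdn_sum => -[i /= iN] _.
case: (ltnP i B) => iB; first by rewrite S2_small.
rewrite -(subnKC iB); set t := i - B.
case: (boolP (2 ^ n %| t)) => nt.
  apply: dvdn_mull; apply: (@dvdn_S2_small n) => //.
  by rewrite dvdn_sub // dvdn_add // dvdn_mull // dvdn_exp2l.
have t0 : 0 < t by case: (posnP t) nt => // ->; rewrite dvdn0.
set j := logn 2 t.
have jn : j < n by rewrite ltnNge -pfactor_dvdn.
have jt : 2 ^ j %| t by rewrite pfactor_dvdn.
have jN : 2 ^ j %| N - (B + t).
  rewrite dvdn_sub ?dvdn_add // ?dvdn_mull ?dvdn_exp2l //; last by lia.
  by apply: dvdn_trans nN; rewrite dvdn_exp2l // ltnW.
have dB : 2 ^ (n - j) %| S2 (B + t) B.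
  case: (posnP (S2 (B + t) B)) => [-> //|S0].
  have := dvdn_mul_S2 n b t; rewrite -/B !pfactor_dvdn ?muln_gt0 ?t0 // lognM //.
  by rewrite -/j; lia.
(* The quotient of [a] by [2 ^ j.+1] has at most [n - j] ones, paid for by [dB]; the remainder goes
   to the induction hypothesis at [j], unless it is 0, when [dB] alone suffices. *)
have q1 : a %/ 2 ^ j.+1 < 2 ^ (n - j).
  by rewrite ltn_divLR ?expn_gt0 // -expnD addnS subnK // ltnW.
have sa := s2D (a %/ 2 ^ j.+1 * 2 ^ j.+1) (a %% 2 ^ j.+1).
rewrite -divn_eq s2_pow_mul in sa.
have := s2_lt_pow q1.
case: (posnP (a %% 2 ^ j.+1)) sa => r0 sa sq.
  rewrite r0 s2_0 addn0 in sa; apply: dvdn_mulr.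
  apply: dvdn_trans dB; apply: dvdn_exp2l.
  by rewrite leq_subLR (leq_trans sa) // (leq_trans sq) // leq_addl.
(* With the quotient in the role of [b], the lower index is again [a]. *)
have := IHn j jn _ (a %% 2 ^ j.+1) (a %/ 2 ^ j.+1) jN.
rewrite r0 ltn_mod expn_gt0 -divn_eq => /(_ isT) dR.
apply: dvdn_trans (dvdn_mul dB dR); rewrite -expnD; apply: dvdn_exp2l.
by rewrite addnBA ?s2_gt0 // leq_sub2r // (leq_trans sa) // leq_add2r.
Qed.

Theorem theorem1p1 (n a b c : nat)
  (ha : 0 < a < 2 ^ n.+1)
  (hle : b * 2 ^ n.+1 + a <= c * 2 ^ n)
  (hc : 1 <= c)
  (hodd : odd c) :
  binary_digit_sum a - 1 <= logn 2 (stirling2 (c * 2 ^ n) (b * 2 ^ n.+1 + a)).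
Proof.
(* As [logn 2 0] is 0, passing to divisibility requires a positive Stirling number, which [hle] and
   [0 < a] provide. *)
rewrite stirling2E -pfactor_dvdn //; first by rewrite dvdn_S2 // dvdn_mull.
by rewrite S2_gt0 // hle andbT addn_gt0; case/andP: ha => ->; rewrite orbT.
Qed.
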